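(* Let $k\in\mathbb{N}$ and $n=2^k-1$. There exist real numbers $\lambda_{i,j}$ ($i\in\{0,1,\dots,n,*\}$, $j\in\{0,1,\dots,n\}$) and $\mu_{i,j}$ ($i\in\{1,\dots,n,*\}$, $j\in\{1,\dots,n\}$) and a symmetric matrix $S\in\mathbb{R}^{(n+2)\times(n+2)}$, depending only on $k$, such that: (i) $\lambda_{i,j}\ge0$ and $\mu_{i,j}\ge0$ for all $i\ne j$; (ii) $S\succeq 0$; (iii) for every $d$, every convex $1$-smooth $f:\mathbb{R}^d\to\mathbb{R}$, every convex $h$ on $\mathbb{R}^d$, every $x_0\in\mathbb{R}^d$ and every minimizer $x_*$ of $F=f+h$, letting $x_1,\dots,x_n$ be the iterates $x_{t+1}=\operatorname{prox}_{\alpha_t h}(x_t-\alpha_t\nabla f(x_t))$ with the silver stepsizes $\alpha_t$, and with the notation below, $$\sum_{i,j}\lambda_{i,j}Q^f_{ij}+\sum_{i,j}\mu_{i,j}Q^h_{ij}=(2\rho^k-1)(F_*-F_n)+\frac{\rho}{2\sqrt2}\|x_0-x_*\|^2-\frac12\big(\|u\|^2+\operatorname{Tr}(VSV^T)\big),$$ where the sums range over the index sets above, $u:=x_0-x_*-\sum_{i=0}^{n-1}\alpha_i g_i-\rho^k g_n-\sum_{j=1}^n c^{(k)}_j s_j-s_*$, and $V:=[\,x_0-x_*\mid s_1\mid\cdots\mid s_n\mid s_*\,]\in\mathbb{R}^{d\times(n+2)}$ is the column-wise concatenation.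
   Context: $\rho=1+\sqrt2$; silver stepsizes $\alpha_t=\rho^{\nu(t+1)-1}+1$ where $\nu(i)$ is the largest $j$ with $2^j\mid i$. $f$ is $1$-smooth if $\nabla f$ is $1$-Lipschitz; $\operatorname{prox}_{\beta h}(x)=\operatorname{argmin}_z h(z)+\frac1{2\beta}\|z-x\|^2$. For $i\in\{0,\dots,n,*\}$: $f_i=f(x_i)$, $g_i=\nabla f(x_i)$, $h_i=h(x_i)$, $F_i=F(x_i)$. For $i=1,\dots,n$, $s_i:=(x_{i-1}-\alpha_{i-1}g_{i-1}-x_i)/\alpha_{i-1}$, a subgradient of $h$ at $x_i$ (so $x_{i}=x_{i-1}-\alpha_{i-1}(g_{i-1}+s_{i})$), and $s_*:=-g_*$, a subgradient of $h$ at $x_*$. Co-coercivities: $Q^f_{ij}=f_i-f_j-\langle g_j,x_i-x_j\rangle-\frac12\|g_i-g_j\|^2$ and $Q^h_{ij}=h_i-h_j-\langle s_j,x_i-x_j\rangle$. With $\pi^{(k)}=[\alpha_0,\dots,\alpha_{n-1}]$, the vector $c^{(k)}\in\mathbb{R}^n$ is defined by $c^{(1)}=[2(\rho-1)]$ and $c^{(k+1)}=[\pi^{(k)},(1+\rho^{-k})(\rho^{k-1}+1),\rho c^{(k)}-(\rho-1-\rho^{-k})\pi^{(k)}]$. *)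

(* Defs.v *)
From HB Require Import structures.
From mathcomp Require Import all_boot all_order all_algebra.
From mathcomp Require Import all_classical all_reals all_analysis.
Set Implicit Arguments. Unset Strict Implicit. Unset Printing Implicit Defensive.
Import Order.TTheory GRing.Theory Num.Theory.
Import numFieldNormedType.Exports.
Local Open Scope ring_scope.

Definition dotv (R : realType) (d : nat) (u v : 'rV[R]_d) : R :=
  \sum_(a < d) u 0 a * v 0 a.
Definition enorm (R : realType) (d : nat) (u : 'rV[R]_d) : R :=
  Num.sqrt (dotv u u).

Definition is_gradient (R : realType) (d : nat) (f : 'rV[R]_d -> R^o)
    (x v : 'rV[R]_d) : Prop :=
  differentiable f x /\ forall w, 'd f x w = dotv v w.

Definition convex_fun (R : realType) (d : nat) (f : 'rV[R]_d -> R) : Prop :=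
  forall (x y : 'rV[R]_d) (t : R), 0 <= t -> t <= 1 ->
    f (t *: x + (1 - t) *: y) <= t * f x + (1 - t) * f y.

Definition is_prox (R : realType) (d : nat) (beta : R) (h : 'rV[R]_d -> R)
    (y z : 'rV[R]_d) : Prop :=
  forall w, h z + (2 * beta)^-1 * enorm (z - y) ^+ 2
            <= h w + (2 * beta)^-1 * enorm (w - y) ^+ 2.

Definition rho (R : realType) : R := 1 + Num.sqrt 2.
Definition nu (i : nat) : nat := logn 2 i.
Definition alpha (R : realType) (t : nat) : R :=
  (rho R) ^ ((nu t.+1)%:Z - 1) + 1.

Definition piv (R : realType) (k : nat) : seq R := mkseq (@alpha R) (2 ^ k - 1).

(* c^(k) (c^(0) is unused; c^(1) = [2(rho - 1)]) *)
Fixpoint cvec (R : realType) (k : nat) : seq R :=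
  match k with
  | 0 => [::]
  | 1 => [:: 2 * (rho R - 1)]
  | k'.+1 =>
      piv R k' ++ (1 + (rho R) ^- k') * ((rho R) ^+ k'.-1 + 1)
        :: [seq (rho R) * cp.1 - ((rho R) - 1 - (rho R) ^- k') * cp.2
           | cp <- zip (cvec R k') (piv R k')]
  end.

(* Indices {0,...,n,*} are encoded as option 'I_n.+1, with None = * . *)
Section Points.
Variables (R : realType) (d n : nat).
Variables (f h : 'rV[R]_d -> R) (gf : 'rV[R]_d -> 'rV[R]_d).
Variables (x : nat -> 'rV[R]_d) (xs : 'rV[R]_d).

Definition pt (i : option 'I_n.+1) : 'rV[R]_d :=
  if i is Some i then x i else xs.
Definition gr (i : option 'I_n.+1) : 'rV[R]_d := gf (pt i).
(* s_i = (x_{i-1} - alpha_{i-1} g_{i-1} - x_i)/alpha_{i-1} for i = 1..n,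
   s_* = - g_* ; (the value at index 0 is never used). *)
Definition sv (i : option 'I_n.+1) : 'rV[R]_d :=
  match i with
  | Some i => (alpha R i.-1)^-1 *:
               (x i.-1 - alpha R i.-1 *: gf (x i.-1) - x i)
  | None => - gf xs
  end.

Definition Qf (i j : option 'I_n.+1) : R :=
  f (pt i) - f (pt j) - dotv (gr j) (pt i - pt j)
  - 2^-1 * enorm (gr i - gr j) ^+ 2.
Definition Qh (i j : option 'I_n.+1) : R :=
  h (pt i) - h (pt j) - dotv (sv j) (pt i - pt j).

Definition Vcol (b : 'I_n.+2) : 'rV[R]_d :=
  if (val b == 0)%N then x 0 - xs
  else if (val b <= n)%N then sv (Some (inord (val b)))
  else sv None.
Definition Vmx : 'M[R]_(d, n.+2) := \matrix_(a < d, b < n.+2) Vcol b 0 a.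
End Points.

(* Main.v *)
Require Import Defs.
From HB Require Import structures.
From mathcomp Require Import all_boot all_order all_algebra.
From mathcomp Require Import all_classical all_reals all_analysis.
From mathcomp Require Import ring lra zify.
Import Order.TTheory GRing.Theory Num.Theory.
Import numFieldNormedType.Exports.
Local Open Scope ring_scope.

(* The multipliers [lam] of the f-inequalities are those of the silver schedule for plain
   gradient descent, glued recursively.  Diagonal entries are free ([Q_ii = 0]), so we choose
   them to make every column of [lam] (including the row [*]) sum to 0; then [lam] is encoded
   by its partial column sums [K_j(i) = \sum_(l >= j) lam_(l,i)].  Matching the [<s_j, g_i>]
   terms forces the multipliers of the h-inequalities: [mu_(i,j) = D_j(i) - D_j(i-1)] with
   [D_j(i) = c_j + alpha_(j-1) K_j(i) / w_i], where [w] is the row [*] of [lam].  Their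
   nonnegativity is the monotonicity of [K_j(i) / w_i] in [i], which survives the gluing.
   Off the diagonal, [S_(i,j) = - (c_i - alpha_(i-1)) (c_j - alpha_(j-1)) - lam_(i-1,j-1)
   - lam_(j-1,i-1) <= 0] and the rows of [s_1, ..., s_n, s_*] sum to 0: this block is a
   weighted Laplacian.  Its edge between [s_1] and [s_*] has weight [c_1 >= sqrt 2], which is
   enough to absorb the terms in [x_0 - x_*].  Given [lam] and [mu], the identity follows,
   coordinate by coordinate, by Abel summation. *)

Section Silver.
Set Implicit Arguments.
Unset Strict Implicit.
Context {R : realType}.
Local Notation rho := (rho R).
Local Notation alpha := (@alpha R).

(** * The silver ratio and the self-similarity of the schedule *)

Lemma rho_sq : rho ^+ 2 = 2 * rho + 1.
Proof.
have h : Num.sqrt (2 : R) ^+ 2 = 2 by rewrite sqr_sqrtr.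
by rewrite /Defs.rho; ring: h.
Qed.

Lemma rho_ge2 : 2 <= rho.
Proof.
have h : Num.sqrt 1 <= Num.sqrt (2 : R) by apply: ler_wsqrtr; lra.
by move: h; rewrite sqrtr1 /Defs.rho; lra.
Qed.

Lemma rho_gt0 : 0 < rho. Proof. exact: lt_le_trans rho_ge2. Qed.

Lemma rhoX_gt0 k : 0 < rho ^+ k. Proof. exact: exprn_gt0 rho_gt0. Qed.

Definition len (k : nat) : nat := (2 ^ k - 1)%N.

Lemma len0 : len 0 = 0%N. Proof. by []. Qed.

Lemma lenS k : len k.+1 = ((len k).+1 + len k)%N.
Proof. by rewrite /len expnS; have := expn_gt0 2 k; lia. Qed.

(** Writing [rho ^+ k / rho] rather than a power with exponent [k - 1] keeps [k = 0] in range, where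
    the step is [1 + 1/rho]. *)
Lemma alpha_len k : alpha (len k) = rho ^+ k / rho + 1.
Proof.
have rho0 := lt0r_neq0 rho_gt0.
rewrite /Defs.alpha /len /nu subn1 prednK ?expn_gt0 // lognX /= muln1.
by rewrite expfzDr // -exprnP exprN1.
Qed.

(** Adding 2^k to i+1 < 2^k keeps its 2-adic valuation v < k: if i+1 = 2^v m with m odd, the
    cofactor becomes m + 2^(k-v), still odd. *)
Lemma alpha_shift k i : (i < len k)%N -> alpha ((len k).+1 + i) = alpha i.
Proof.
rewrite /Defs.alpha /len /nu => ilt; congr (rho ^ (_%:Z - 1) + 1).
have pk : (0 < 2 ^ k)%N by rewrite expn_gt0.
have -> : ((2 ^ k - 1).+1 + i).+1 = (i.+1 + 2 ^ k)%N by lia.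
have il : (i.+1 < 2 ^ k)%N by lia.
have lt : (logn 2 i.+1 < k)%N.
  rewrite ltnNge; apply/negP => kl.
  have : (2 ^ k %| i.+1)%N by rewrite pfactor_dvdn.
  by move/dvdn_leq => /(_ isT); lia.
have [m cop def_i] := pfactor_coprime (isT : prime 2) (ltn0Sn i).
have -> : (i.+1 + 2 ^ k = (m + 2 ^ (k - logn 2 i.+1)) * 2 ^ logn 2 i.+1)%N.
  by rewrite mulnDl -expnD subnK ?(ltnW lt) // -def_i.
rewrite lognM ?addn_gt0 ?expn_gt0 ?orbT // pfactorK // logn_coprime ?add0n //.
by move: cop; rewrite !coprime2n oddD oddX subn_eq0 leqNgt lt /= addbF.
Qed.


(** * The glued multipliers of the f-inequalities *)

Variant half_spec n : nat -> Type :=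
| HalfLow i of (i < n)%N : half_spec n i
| HalfMid : half_spec n n
| HalfHigh i of (i < n)%N : half_spec n (n.+1 + i)
| HalfTop : half_spec n (n.+1 + n).

(** Two copies of n+1 points each are glued. [HalfMid] is the last point of the first copy, from
    which the new step is taken; [HalfTop], of index [len k.+1] when [n = len k], is the last point
    of the second. *)
Lemma halfP n i : (i <= n.+1 + n)%N -> half_spec n i.
Proof.
move=> le; case: (ltngtP i n) => [lt|gt|->]; [exact: HalfLow| |exact: HalfMid].
rewrite -(subnKC gt); case: (ltngtP (i - n.+1) n) => [lt|gt2|->].
- exact: HalfHigh.
- by exfalso; lia.
- exact: HalfTop.
Qed.

(* Row [*] of [lam]. *)
Definition wt k i : R := if (i < len k)%N then alpha i else rho ^+ k.

(** What gluing adds to the last row of [lam] in the columns of the second copy, hence to every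
    K_j(i) with j in that copy. In the last column it falls on the diagonal; its value there is the
    one that leaves [rho] at the entry [(len k, len k.+1)]. *)
Definition bump_wt k i : R :=
  if (i < len k)%N then rho * alpha i else rho ^+ 2 * rho ^+ k - rho * rho ^+ k - rho.

(* [tail k j i] is [K_j(i)], for [i <= len k].  Gluing two copies of the certificate at the
   step [alpha (len k)] adds to [lam], scaled by [rho ^+ 2] in the second half, the entries
   [rho * alpha i] from the rows [len k] and [len k.+1] to the columns of the second half,
   [rho ^+ k] at [(len k.+1, len k)] and [rho] at [(len k, len k.+1)]. *)
Fixpoint tail k j i : R :=
  if k is k'.+1 then
    let n := len k' in
    if (i < n)%N then tail k' j i
    else if i == n then
      if (j <= n)%N then tail k' j n + (rho ^+ k' - alpha n)
      else if (j <= n.+1 + n)%N then rho ^+ k' else 0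
    else if (j <= n)%N then - wt k i
    else if (j <= n.+1 + n)%N then
      rho ^+ 2 * tail k' (j - n.+1)%N (i - n.+1)%N + bump_wt k' (i - n.+1)
    else 0
  else if j is 0%N then -1 else 0.

Lemma wt_lt k i : (i < len k)%N -> wt k i = alpha i.
Proof. by rewrite /wt => ->. Qed.

Lemma wt_len k : wt k (len k) = rho ^+ k.
Proof. by rewrite /wt ltnn. Qed.

Lemma alpha_gt0 i : 0 < alpha i.
Proof. by rewrite addr_gt0 // exprz_gt0 // rho_gt0. Qed.

Lemma wt_gt0 k i : 0 < wt k i.
Proof. by rewrite /wt; case: ifP => _; [exact: alpha_gt0 | exact: rhoX_gt0]. Qed.

Lemma wtS_low k i : (i <= len k)%N -> wt k.+1 i = alpha i.
Proof. by move=> le; rewrite wt_lt // lenS; lia. Qed.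

Lemma wtS_high k i : (i < len k)%N -> wt k.+1 ((len k).+1 + i) = alpha i.
Proof. by move=> lt; rewrite wt_lt ?alpha_shift // lenS; lia. Qed.

Lemma wtS_top k : wt k.+1 ((len k).+1 + len k) = rho * rho ^+ k.
Proof. by rewrite -lenS wt_len exprS. Qed.

Lemma bump_wt_lt k i : (i < len k)%N -> bump_wt k i = rho * alpha i.
Proof. by rewrite /bump_wt => ->. Qed.

Lemma bump_wt_len k :
  bump_wt k (len k) = rho ^+ 2 * rho ^+ k - rho * rho ^+ k - rho.
Proof. by rewrite /bump_wt ltnn. Qed.

Lemma tailS_low k j i : (i < len k)%N -> tail k.+1 j i = tail k j i.
Proof. by move=> /= ->. Qed.

Lemma tailS_mid_low k j : (j <= len k)%N ->
  tail k.+1 j (len k) = tail k j (len k) + (rho ^+ k - alpha (len k)).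
Proof. by move=> /= ->; rewrite ltnn eqxx. Qed.

Lemma tailS_mid_high k j : (j <= len k)%N ->
  tail k.+1 ((len k).+1 + j) (len k) = rho ^+ k.
Proof.
by move=> le /=; rewrite ltnn eqxx leq_add2l le ifF //; apply/negbTE; lia.
Qed.

Lemma tailS_high_low k j i : (j <= len k)%N ->
  tail k.+1 j ((len k).+1 + i) = - wt k.+1 ((len k).+1 + i).
Proof.
move=> le /=; rewrite le.
by do 2 (rewrite ifF; last by apply/negbTE; lia).
Qed.

Lemma tailS_high k j i : (j <= len k)%N ->
  tail k.+1 ((len k).+1 + j) ((len k).+1 + i) = rho ^+ 2 * tail k j i + bump_wt k i.
Proof.
move=> le /=; rewrite leq_add2l le !addKn.
by do 3 (rewrite ifF; last by apply/negbTE; lia).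
Qed.

Lemma tailS_mid_high0 k : tail k.+1 (len k).+1 (len k) = rho ^+ k.
Proof. by have := tailS_mid_high (leq0n (len k)); rewrite addn0. Qed.

Lemma tailS_high0 k i :
  tail k.+1 (len k).+1 ((len k).+1 + i) = rho ^+ 2 * tail k 0 i + bump_wt k i.
Proof. by have := tailS_high i (leq0n (len k)); rewrite addn0. Qed.

Arguments tail : simpl never.

Lemma tail_gt k j i : (i <= len k)%N -> (len k < j)%N -> tail k j i = 0.
Proof.
elim: k j i => [|k IH] j i; first by rewrite len0 leqn0 => /eqP ->; case: j.
rewrite lenS => le lt.
have [lti|nlt] := ltnP i (len k); first by rewrite tailS_low // IH //; lia.
have jn : (j <= len k)%N = false by lia.
have jN : (j <= (len k).+1 + len k)%N = false by lia.
by rewrite /tail -/tail ltnNge nlt jn jN /=; case: ifP.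
Qed.

Lemma tail_succ_len k i : (i <= len k)%N -> tail k (len k).+1 i = 0.
Proof. by move=> le; rewrite tail_gt. Qed.

Lemma tailS_succ_top k i : (i <= (len k).+1 + len k)%N ->
  tail k.+1 ((len k).+1 + len k).+1 i = 0.
Proof. by move=> le; rewrite tail_gt ?lenS. Qed.

Lemma tail_0 k i : (i <= len k)%N -> tail k 0 i = - wt k i.
Proof.
elim: k i => [|k IH] i.
  by rewrite len0 leqn0 => /eqP -> /=; rewrite /wt len0 ltnn expr0.
rewrite lenS => /halfP[{}i lti||{}i lti|].
- by rewrite tailS_low // wtS_low ?(ltnW lti) // IH ?(ltnW lti) // wt_lt.
- by rewrite tailS_mid_low // IH // wt_len wtS_low //; ring.
- by rewrite tailS_high_low.
- by rewrite tailS_high_low.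
Qed.

(** With q = rho^k / rho, the seam quantities become polynomials in rho and q, and the identities
    there are checked modulo rho^2 = 2 rho + 1. *)
Lemma glue_step k : {q : R | [/\ 0 < q, alpha (len k) = q + 1 & rho ^+ k = rho * q]}.
Proof.
exists (rho ^+ k / rho); split; first by rewrite divr_gt0 ?rhoX_gt0 ?rho_gt0.
- exact: alpha_len.
- by rewrite mulrC divfK // lt0r_neq0 ?rho_gt0.
Qed.

(** This is the nonnegativity of [lam] off the diagonal. Within a copy it is inherited; across the
    seam the new entries are [rho ^+ k], [rho * alpha i] and [rho]. *)
Lemma tail_anti k m i : (i <= len k)%N -> m != i -> tail k m.+1 i <= tail k m i.
Proof.
elim: k m i => [|k IH] m i.
  by rewrite len0 leqn0 => /eqP ->; case: m.
rewrite lenS => le mi.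
have [mle|mgt] := leqP m ((len k).+1 + len k); last first.
  by rewrite !tail_gt // ?lenS // (leq_trans mgt).
have r0 := rhoX_gt0 k; have rho2 := rho_ge2.
case: (halfP le) mi => [{le} {}i lti||{le} {}i lti|] mi.
- by rewrite !tailS_low // IH // ltnW.
- case: (halfP mle) mi => [{mle} {}m ltm||{mle} {}m ltm|] mi.
  + rewrite !tailS_mid_low ?(ltnW ltm) // lerD2r IH //; lia.
  + by rewrite eqxx in mi.
  + by rewrite -addnS !tailS_mid_high ?(ltnW ltm).
  + rewrite tailS_mid_high // tail_gt ?lenS //; first exact: ltW.
    lia.
- case: (halfP mle) mi => [{mle} {}m ltm||{mle} {}m ltm|] mi.
  + by rewrite !tailS_high_low ?(ltnW ltm).
  + have := alpha_gt0 i; have := tail_0 (ltnW lti); rewrite wt_lt // => t0 a0.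
    rewrite tailS_high0 tailS_high_low // t0.
    rewrite wtS_high // bump_wt_lt //.
    have := rho_sq; nra.
  + by rewrite -addnS !tailS_high ?(ltnW ltm) // lerD2r ler_pM2l ?exprn_gt0 ?rho_gt0 // IH //; lia.
  + rewrite tailS_high // bump_wt_lt // tail_gt ?lenS //; try lia.
    have : tail k (len k).+1 i <= tail k (len k) i by rewrite IH //; lia.
    rewrite (tail_gt (j := (len k).+1)) //; last lia.
    have := alpha_gt0 i => a0 t0.
    by rewrite addr_ge0 ?mulr_ge0 ?exprn_ge0 //; lra.
- case: (halfP mle) mi => [{mle} {}m ltm||{mle} {}m ltm|] mi.
  + by rewrite !tailS_high_low ?(ltnW ltm).
  + have t0 := tail_0 (leqnn (len k)); rewrite wt_len in t0.
    rewrite tailS_high0 tailS_high_low // t0.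
    rewrite wtS_top // bump_wt_len //.
    have := rho_sq; nra.
  + by rewrite -addnS !tailS_high ?(ltnW ltm) // lerD2r ler_pM2l ?exprn_gt0 ?rho_gt0 // IH //; lia.
  + by rewrite eqxx in mi.
Qed.

(** * Sums of the steps and of the partial column sums; the quadratic relation *)

Lemma sum_len (F : nat -> R) k :
  \sum_(i < (len k.+1).+1) F i =
  \sum_(i < len k) F i + F (len k)
  + (\sum_(i < len k) F ((len k).+1 + i)%N + F ((len k).+1 + len k)%N).
Proof.
rewrite lenS -addnS big_split_ord big_ord_recr; congr (_ + _).
by rewrite big_ord_recr.
Qed.

Lemma sum_alpha k : \sum_(i < len k) alpha i = rho ^+ k - 1.
Proof.
elim: k => [|k IH]; first by rewrite len0 big_ord0 subrr.
have [q [_ aq rq]] := glue_step k.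
rewrite lenS big_split_ord big_ord_recr /= IH.
under eq_bigr => i _ do rewrite alpha_shift //.
rewrite IH exprS rq aq; ring: rho_sq.
Qed.

(** Since the total does not depend on j, every row j < [len k] of [lam] sums to 0 and the last one
    to 1 - 2 rho^k. As the columns sum to 0 too, f_j cancels for j < [len k]. *)
Lemma sum_tail k j : (j <= len k)%N ->
  \sum_(i < (len k).+1) tail k j i = 1 - 2 * rho ^+ k.
Proof.
elim: k j => [|k IH] j.
  by rewrite len0 leqn0 => /eqP ->; rewrite big_ord1 /tail expr0; ring.
rewrite sum_len exprS; have [q [_ aq rq]] := glue_step k => le.
have Sa := sum_alpha k.
have Sw : \sum_(i < len k) wt k.+1 ((len k).+1 + i) = rho ^+ k - 1.
  by rewrite -Sa; apply: eq_bigr => i _; rewrite wtS_high.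
rewrite lenS in le; have [jle|jgt] := leqP j (len k).
- have := IH _ jle; rewrite big_ord_recr /= => IHj.
  under eq_bigr => i _ do rewrite tailS_low //.
  under [X in _ + (X + _)]eq_bigr => i _ do rewrite tailS_high_low //.
  rewrite sumrN Sw tailS_mid_low // tailS_high_low // wtS_top aq.
  rewrite addrA [X in X + _ + _ = _]addrA IHj rq; ring: rho_sq.
- rewrite -(subnKC jgt); set j' := (j - _)%N.
  have jle : (j' <= len k)%N by lia.
  have IHj : \sum_(i < len k) tail k j' i = 1 - 2 * rho ^+ k - tail k j' (len k).
    by rewrite -(IH _ jle) big_ord_recr addrK.
  rewrite big1 => [|i _]; last by rewrite tailS_low // tail_gt ?leq_addr // ltnW.
  under [X in _ + (X + _)]eq_bigr => i _ do rewrite tailS_high // bump_wt_lt //.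
  rewrite big_split /= -!mulr_sumr IHj Sa.
  rewrite tailS_mid_high // tailS_high // bump_wt_len rq; ring: rho_sq.
Qed.

(* Equates the coefficients of [<g_m, g_j>] in the certificate for plain gradient descent. *)
Lemma tail_descent k m j : (m <= len k)%N -> (j <= len k)%N ->
  tail k m j + (wt k m - 1) * tail k m.+1 j
  + (tail k j m + (wt k j - 1) * tail k j.+1 m)
  = - (wt k m * wt k j)
    - (2 * rho ^+ k - 1) * ((m == len k) && (j == len k))%:R.
Proof.
(* By symmetry ten of the sixteen pairs of positions remain. Pairs within one copy reduce to the
   induction hypothesis, multiplied by rho^2 in the second copy; pairs across the seam are computed
   directly. *)
wlog mj : m j / (m <= j)%N.
  move=> H ml jl; have [le|lt] := leqP m j; first exact: H.
  by rewrite addrC H ?(ltnW lt) // [wt k j * _]mulrC andbC.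
elim: k m j mj => [|k IH] m j mj.
  rewrite len0 !leqn0 => /eqP -> /eqP ->.
  by rewrite /tail /wt len0 ltnn expr0 eqxx /=; ring.
have [q [_ aq rq]] := glue_step k.
have t0l := tail_0 (leqnn (len k)); rewrite wt_len in t0l.
have topF i : (i < (len k).+1 + len k)%N ->
    (i == (len k).+1 + len k)%N = false by lia.
rewrite lenS => mN jN.
case: (halfP mN) mj => [{mN} {}m ltm||{mN} {}m ltm|] mj;
case: (halfP jN) mj => [{jN} {}j ltj||{jN} {}j ltj|] mj; try by exfalso; lia.
- rewrite !topF; try lia; rewrite /= !(mulr0, subr0).
  have := IH m j mj (ltnW ltm) (ltnW ltj).
  rewrite !tailS_low // !wtS_low ?(ltnW ltm) ?(ltnW ltj) // !wt_lt //.
  by rewrite !ltn_eqF //= !(mulr0, subr0).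
- rewrite !topF; try lia; rewrite /= !(mulr0, subr0).
  have := IH m _ mj (ltnW ltm) (leqnn _).
  rewrite !(tailS_low _ ltm) !tailS_mid_low ?(ltnW ltm) // !wtS_low ?(ltnW ltm) //.
  rewrite tail_succ_len ?(ltnW ltm) // wt_lt // wt_len ltn_eqF // aq rq /= !(mulr0, subr0).
  move=> IHm; lra.
- rewrite !topF; try lia; rewrite /= !(mulr0, subr0).
  rewrite !tailS_high_low ?(ltnW ltm) // !(tailS_low _ ltm).
  by rewrite !tail_gt ?(ltnW ltm) ?wtS_high ?wtS_low ?(ltnW ltm) //; try lia; ring.
- rewrite (topF m); last lia; rewrite /= !(mulr0, subr0).
  rewrite !tailS_high_low ?(ltnW ltm) // !(tailS_low _ ltm).
  by rewrite !tail_gt ?(ltnW ltm) ?wtS_top ?wtS_low ?(ltnW ltm) //; try lia; ring.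
- rewrite !topF; try lia; rewrite /= !(mulr0, subr0).
  have := IH _ _ mj (leqnn _) (leqnn _).
  rewrite tailS_mid_high0 tailS_mid_low // wtS_low // eqxx /= mulr1.
  rewrite tail_succ_len // wt_len aq rq => IHm.
  have : q ^+ 2 * rho ^+ 2 = q ^+ 2 * (2 * rho + 1) by rewrite rho_sq.
  lra.
- rewrite !topF; try lia; rewrite /= !(mulr0, subr0).
  rewrite tailS_high_low // tailS_high0 -addnS !tailS_mid_high // ?(ltnW ltj) //.
  rewrite tail_0 ?(ltnW ltj) // (wt_lt ltj) !wtS_high // !wtS_low // bump_wt_lt // aq rq.
  ring: rho_sq.
- rewrite topF; last lia; rewrite /= !(mulr0, subr0).
  rewrite tailS_high_low // tailS_high0 tailS_mid_high // tailS_succ_top; last lia.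
  rewrite t0l bump_wt_len wtS_top wtS_low // aq rq.
  ring: rho_sq.
- rewrite !topF; try lia; rewrite /= !(mulr0, subr0).
  have {}mj : (m <= j)%N by lia.
  have := IH m j mj (ltnW ltm) (ltnW ltj).
  rewrite (wt_lt ltm) (wt_lt ltj) (ltn_eqF ltm) /= !(mulr0, subr0) => IHm.
  rewrite -!addnS !tailS_high ?(ltnW ltm) ?(ltnW ltj) // !wtS_high // !bump_wt_lt //.
  have := congr1 ( *%R (rho ^+ 2)) IHm.
  have : alpha m * alpha j * rho ^+ 2 = alpha m * alpha j * (2 * rho + 1) by rewrite rho_sq.
  lra.
- rewrite topF; last lia; rewrite /= !(mulr0, subr0).
  have := IH m _ (ltnW ltm) (ltnW ltm) (leqnn _).
  rewrite (wt_lt ltm) wt_len (ltn_eqF ltm) /= !(mulr0, subr0).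
  rewrite tail_succ_len ?(ltnW ltm) // => IHm.
  rewrite tailS_succ_top; last lia.
  rewrite -addnS !tailS_high ?(ltnW ltm) // wtS_high // wtS_top (bump_wt_lt ltm) bump_wt_len.
  have := congr1 ( *%R (rho ^+ 2)) IHm; have := rho_sq; lra.
- have := IH _ _ (leqnn _) (leqnn _) (leqnn _); rewrite wt_len eqxx /= mulr1 => IHm.
  rewrite tailS_high // tailS_succ_top //.
  rewrite tail_succ_len // in IHm.
  rewrite bump_wt_len wtS_top eqxx /= mulr1 (exprS _ k).
  have := congr1 ( *%R (rho ^+ 2)) IHm; have := rho_sq; lra.
Qed.

(** * Signs of K_j(i), and monotonicity of K_j(i) / w_i in i *)

Lemma rhoX_ge1 k : 1 <= rho ^+ k.
Proof. by rewrite exprn_ege1 //; have := rho_ge2; lra. Qed.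

(** As j grows, K_j(i) decreases from -w_i at j = 0 down to the diagonal j = i, may jump up when
    passing it, and then decreases to 0 at j = [len k] + 1. This gives the present bound and the
    next one. *)
Lemma tail_le_wt k j i : (i <= len k)%N -> (j <= i)%N -> tail k j i <= - wt k i.
Proof.
move=> le; elim: j => [|j IH] ji; first by rewrite tail_0.
by apply: le_trans (IH (ltnW ji)); rewrite tail_anti // ltn_eqF.
Qed.

Lemma tail_ge0 k j i : (i <= len k)%N -> (i < j)%N -> 0 <= tail k j i.
Proof.
move=> le ij; have [jl|lj] := leqP j (len k); last by rewrite tail_gt.
(* Downward induction on the row, from the zero row [(len k).+1]. *)
suff H d : (i < len k - d)%N -> 0 <= tail k (len k - d) i.
  by rewrite -(subKn jl) H // subKn.
elim: d => [|d IH] id.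
  rewrite subn0 in id *; rewrite -(tail_succ_len le) tail_anti //.
  by rewrite gtn_eqF.
have idS : (i < len k - d)%N by lia.
apply: le_trans (IH idS) _.
by rewrite (_ : len k - d = (len k - d.+1).+1)%N ?tail_anti ?gtn_eqF //; lia.
Qed.

Definition ratio k j i : R := tail k j i / wt k i.

Lemma ratio_le k j i : (i <= len k)%N -> (j <= i)%N -> ratio k j i <= - 1.
Proof.
by move=> le ji; rewrite ler_pdivrMr ?wt_gt0 // mulN1r tail_le_wt.
Qed.

Lemma ratio_ge0 k j i : (i <= len k)%N -> (i < j)%N -> 0 <= ratio k j i.
Proof. by move=> le ij; rewrite divr_ge0 ?tail_ge0 // ltW ?wt_gt0. Qed.

Lemma ratio_0 k i : (i <= len k)%N -> ratio k 0 i = - 1.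
Proof. by move=> le; rewrite /ratio tail_0 // mulNr divff // gt_eqF ?wt_gt0. Qed.

Lemma ratio_gt k j i : (i <= len k)%N -> (len k < j)%N -> ratio k j i = 0.
Proof. by move=> le lt; rewrite /ratio tail_gt // mul0r. Qed.

Lemma ratioS_low k j i : (i < len k)%N -> ratio k.+1 j i = ratio k j i.
Proof. by move=> lt; rewrite /ratio tailS_low // wtS_low ?(ltnW lt) // wt_lt. Qed.

Lemma ratioS_mid_low k j : (j <= len k)%N ->
  ratio k.+1 j (len k) = (tail k j (len k) + rho ^+ k) / alpha (len k) - 1.
Proof.
move=> le; rewrite /ratio tailS_mid_low // wtS_low //.
by field; rewrite gt_eqF ?alpha_gt0.
Qed.

Lemma ratioS_mid_high k j : (j <= len k)%N ->
  ratio k.+1 ((len k).+1 + j) (len k) = rho ^+ k / alpha (len k).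
Proof. by move=> le; rewrite /ratio tailS_mid_high // wtS_low. Qed.

Lemma ratioS_high_low k j i : (j <= len k)%N ->
  ratio k.+1 j ((len k).+1 + i) = - 1.
Proof.
by move=> le; rewrite /ratio tailS_high_low // mulNr divff // gt_eqF ?wt_gt0.
Qed.

Lemma ratioS_high k j i : (j <= len k)%N -> (i < len k)%N ->
  ratio k.+1 ((len k).+1 + j) ((len k).+1 + i) = rho ^+ 2 * ratio k j i + rho.
Proof.
move=> le lt; rewrite /ratio tailS_high // wtS_high // (wt_lt lt) bump_wt_lt //.
by field; rewrite gt_eqF ?alpha_gt0.
Qed.

Lemma ratioS_top k j : (j <= len k)%N ->
  ratio k.+1 ((len k).+1 + j) ((len k).+1 + len k) =
  rho * (tail k j (len k) + rho ^+ k) / rho ^+ k - 1 - (rho ^+ k)^-1.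
Proof.
move=> le; rewrite /ratio tailS_high // wtS_top bump_wt_len.
by field; rewrite !gt_eqF ?rhoX_gt0 ?rho_gt0.
Qed.

(* The second inequality, about the step to be appended next, is what makes the
   first one inductive. *)
Lemma ratio_mono_glue k :
  (forall j i, (0 < j)%N -> (i < len k)%N -> i.+1 != j ->
     ratio k j i <= ratio k j i.+1) /\
  (forall j i, (0 < j)%N -> (j <= i)%N -> i.+1 = len k ->
     ratio k j i + 1 <= (tail k j (len k) + rho ^+ k) / alpha (len k)).
Proof.
elim: k => [|k [mono glue]]; first by split=> j i; rewrite len0.
have [q [q0 aq rq]] := glue_step k.
have r0 := rhoX_gt0 k; have r1 := rhoX_ge1 k; have p2 := rho_ge2; have ps := rho_sq.
have a0 := alpha_gt0 (len k).
(* [X] is one plus the ratio of column [len k] after gluing; it is nonpositive by [tail_le_wt]. *)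
have gap j i : (0 < j)%N -> (j <= i)%N -> i.+1 = len k -> exists X : R,
    [/\ X <= 0, ratio k j i + 1 <= X & tail k j (len k) + rho ^+ k = X * alpha (len k)].
  move=> j0 ji il; exists ((tail k j (len k) + rho ^+ k) / alpha (len k)); split.
  - have jn : (j <= len k)%N by lia.
    by have := tail_le_wt (leqnn _) jn; rewrite ler_pdivrMr // mul0r wt_len; lra.
  - exact: glue.
  - by rewrite divfK // gt_eqF.
split=> j i j0.
- rewrite lenS => iN ij.
  have [jl|] := leqP j (len k).
    have [ilt|ige] := ltnP i (len k).
      rewrite (ratioS_low _ ilt); have [iSl|iSg] := ltnP i.+1 (len k).
        by rewrite ratioS_low // mono.
      have il : i.+1 = len k by lia.
      by rewrite il ratioS_mid_low // lerBrDr glue //; lia.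
    rewrite -(subnKC ige) -addSn ratioS_high_low // ratio_le ?lenS //; lia.
  have [jN|Nj] := leqP j ((len k).+1 + len k); last first.
    by rewrite !ratio_gt ?lenS //; lia.
  move=> jg; rewrite -(subnKC jg) in ij jN *; set j' := (j - _)%N in ij jN *.
  have jle : (j' <= len k)%N by lia.
  move: j' jle ij jN => {j0 jg} {}j jle ij jN.
  have iN' := ltnW iN.
  case: (halfP iN') iN ij => [{iN'} {}i lti||{iN'} {}i lti|] iN ij; last by lia.
  + rewrite ratioS_low // ratio_gt ?ratio_ge0 ?lenS //; lia.
  (* Crossing the seam: the ratio rho^k / alpha = rho q / (q + 1) is at most rho, and the first
     ratio of the second copy is at least rho. *)
  + have j0 : (0 < j)%N by lia.
    have n0 : (0 < len k)%N by lia.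
    have := ratioS_high jle n0; rewrite addn0 => ->; rewrite ratioS_mid_high //.
    have : 0 <= rho ^+ 2 * ratio k j 0.
      by rewrite mulr_ge0 ?exprn_ge0 ?ratio_ge0 //; lra.
    have : rho ^+ k / alpha (len k) <= rho.
      by rewrite ler_pdivrMr // aq rq; nra.
    lra.
  + rewrite ratioS_high // -addnS; have [iSl|iSg] := ltnP i.+1 (len k).
      rewrite ratioS_high // lerD2r ler_pM2l ?exprn_gt0 ?rho_gt0 //.
      have [->|j0] := posnP j; first by rewrite !ratio_0 // ltnW.
      by rewrite mono //; lia.
    have il : i.+1 = len k by lia.
    rewrite il ratioS_top //.
    have u1 : (rho ^+ k)^-1 <= 1 by rewrite invf_le1.
    have [j0|j0] := posnP j.
      rewrite j0 ratio_0 ?(ltnW lti) // tail_0 // wt_len addNr mulr0 mul0r; lra.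
    have [X [X0 qX ->]] := gap j i j0 ltac:(lia) il.
    set u := (rho ^+ k)^-1 in u1 *.
    (* The bound ratio <= X - 1 suffices: the terms in X compare because X <= 0 and alpha / rho^k <=
       rho, the constants because u <= 1. *)
    have au : alpha (len k) * u <= rho by rewrite ler_pdivrMr // aq rq; nra.
    have : 0 <= X * (alpha (len k) * u - rho) by rewrite mulr_le0 // subr_le0.
    nra.
- rewrite lenS => ji il.
  have aN : alpha ((len k).+1 + len k) = rho ^+ k + 1.
    by rewrite -lenS alpha_len exprSr mulfK // gt_eqF ?rho_gt0.
  have [n0|n0] := posnP (len k); first by rewrite n0 in il; lia.
  have -> : i = ((len k).+1 + (len k).-1)%N by lia.
  have nlt : ((len k).-1 < len k)%N by lia.
  rewrite aN (exprS _ k); have [jl|jg] := leqP j (len k).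
    rewrite ratioS_high_low // tailS_high_low // wtS_top; lra.
  rewrite -(subnKC jg) in ji *; set j' := (j - _)%N in ji *.
  have jle : (j' <= (len k).-1)%N by lia.
  clear ji; move: j' jle => {j0 jg} {}j jle; have jn : (j <= len k)%N by lia.
  rewrite ratioS_high // tailS_high // bump_wt_len ler_pdivlMr; last lra.
  have [->|j0] := posnP j.
    rewrite ratio_0 ?(ltnW nlt) // tail_0 // wt_len; nra.
  have [X [X0 qX def_X]] := gap j _ j0 jle (prednK n0).
  have -> : tail k j (len k) = X * alpha (len k) - rho ^+ k by rewrite -def_X addrK.
  (* The step appended next is rho^k + 1, at least [alpha (len k)]; the sign of X reverses this
     comparison. *)
  have : X * (rho ^+ k + 1) <= X * alpha (len k) by rewrite ler_wnM2l // aq rq; nra.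
  have : (ratio k j (len k).-1 + 1) * (rho ^+ k + 1) <= X * (rho ^+ k + 1).
    by rewrite ler_wpM2r //; lra.
  nra.
Qed.

Lemma ratio_mono k j i : (0 < j)%N -> (i < len k)%N -> i.+1 != j ->
  ratio k j i <= ratio k j i.+1.
Proof. by case: (ratio_mono_glue k) => H _; apply: H. Qed.

(** * The first column of K, and the vector c read off its last column *)

Lemma tail_col0 k j : (0 < k)%N -> (0 < j)%N -> tail k j 0 = (j == 1)%:R.
Proof.
elim: k j => // -[|k] IH j _ j0; last first.
  by rewrite tailS_low ?IH // lenS.
by case: j j0 => [//|[|j]] _; rewrite /tail len0.
Qed.

Lemma size_cvec k : (0 < k)%N -> size (cvec R k) = len k.
Proof.
elim: k => [//|[|k] IH] _; first by [].
rewrite [cvec _ _]/= size_cat /= size_map size_zip IH // !size_mkseq.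
by rewrite -/(len k.+1) minnn addnS [RHS]lenS addSn.
Qed.

Lemma cvecSS k : cvec R k.+2 = piv R k.+1 ++
  (1 + rho ^- k.+1) * (rho ^+ k + 1) ::
  [seq rho * cp.1 - (rho - 1 - rho ^- k.+1) * cp.2 | cp <- zip (cvec R k.+1) (piv R k.+1)].
Proof. by []. Qed.

Arguments cvec : simpl never.

(** The recursion of c is that of the last column of K: the three blocks of c^(k+1) come from rows 1
    to [len k], from row [(len k).+1], and from the later rows. This is what makes D_j vanish at i =
    [len k]. *)
Lemma tail_cvec k j : (0 < k)%N -> (j < len k)%N ->
  alpha j * tail k j.+1 (len k) = - (rho ^+ k * nth 0 (cvec R k) j).
Proof.
elim: k j => // -[_|k IH] j _.
  rewrite lenS len0 addn0 ltnS leqn0 => /eqP ->.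
  have := @tailS_high0 0 0; rewrite len0 addn0 => ->.
  rewrite tail_0 // wt_len bump_wt_len (_ : nth _ _ _ = 2 * (rho - 1)) //.
  rewrite -[alpha 0]/(alpha (len 0)) alpha_len expr0 expr1 div1r.
  by field: rho_sq; rewrite gt_eqF ?rho_gt0.
rewrite lenS cvecSS nth_cat size_mkseq -/(len k.+1) => jN.
have r0 := rhoX_gt0 k.+1; have jN' := ltnW jN.
have aN : alpha (len k.+1) = rho ^+ k + 1.
  by rewrite alpha_len exprSr mulfK // gt_eqF ?rho_gt0.
case: (halfP jN') jN => [{jN'} {}j ltj||{jN'} {}j ltj|] jN; last by rewrite ltnn in jN.
- rewrite ltj nth_mkseq // tailS_high_low // wtS_top (exprS _ k.+1); ring.
- rewrite ltnn subnn /= tailS_high0 tail_0 // wt_len bump_wt_len aN (exprS _ k.+1).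
  by field: rho_sq; rewrite gt_eqF.
- rewrite ifF; last by apply/negbTE; lia.
  rewrite (_ : _ - _ = j.+1)%N /=; last lia.
  rewrite (nth_map (0, 0)) ?size_zip ?size_cvec ?size_mkseq ?minnn //.
  rewrite nth_zip ?size_cvec ?size_mkseq //= /piv nth_mkseq // -addnS tailS_high //.
  rewrite bump_wt_len alpha_shift // (exprS _ k.+1).
  have := congr1 ( *%R (rho ^+ 2)) (IH j isT ltj) => IHj.
  transitivity (rho ^+ 2 * (alpha j * tail k.+1 j.+1 (len k.+1))
    + alpha j * (rho ^+ 2 * rho ^+ k.+1 - rho * rho ^+ k.+1 - rho)); first by ring.
  by rewrite IHj; field: rho_sq; rewrite gt_eqF.
Qed.

(** * Totals of c and of the multipliers for fixed k *)

Section Certificate.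
Variables (k : nat) (k_gt0 : (0 < k)%N).
Local Notation n := (len k).
Local Notation r := (rho ^+ k).
Local Notation K := (tail k).
Local Notation w := (wt k).
Local Notation cv := (nth 0 (cvec R k)).

Lemma len_gt0 : (0 < n)%N.
Proof. by case: k k_gt0 => // k' _; rewrite lenS. Qed.

(** Turns the weights K_i - K_(i+1) on values into weights K on consecutive differences, where the
    recursion for the iterates applies. *)
Lemma abel (a phi : nat -> R) m :
  \sum_(i < m.+1) (a i - a i.+1) * phi i =
  a 0 * phi 0 - a m.+1 * phi m + \sum_(i < m) a i.+1 * (phi i.+1 - phi i).
Proof.
elim: m => [|m IH]; first by rewrite big_ord1 big_ord0; ring.
by rewrite big_ord_recr IH [in RHS]big_ord_recr /=; ring.
Qed.

Lemma sum_wt : \sum_(i < n.+1) w i = 2 * r - 1.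
Proof.
rewrite big_ord_recr /= wt_len (eq_bigr (fun i : 'I_n => alpha i)) => [|i _].
  by rewrite sum_alpha; ring.
by rewrite wt_lt.
Qed.

Lemma sum_wt_tail (phi : nat -> R) i : (i <= n)%N ->
  \sum_(m < n.+1) w m * K m.+1 i * phi m = \sum_(m < n) alpha m * K m.+1 i * phi m.
Proof.
move=> le; rewrite big_ord_recr /= tail_succ_len // mulr0 mul0r addr0.
by apply: eq_bigr => m _; rewrite wt_lt.
Qed.

(** Sum [tail_descent] over m, evaluating the other terms by Abel summation and [sum_tail]. The case
    i < n totals the h-multipliers, the case i = n totals c. *)
Lemma sum_alpha_tail i : (i <= n)%N ->
  \sum_(m < n) alpha m * K m.+1 i =
  if (i < n)%N then alpha i else - (r * (2 * r - 2)).
Proof.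
move=> le; have : \sum_(m < n.+1) (K m i + (w m - 1) * K m.+1 i
    + (K i m + (w i - 1) * K i.+1 m)) =
  \sum_(m < n.+1) (- (w m * w i) - (2 * r - 1) * ((m == n :> nat) && (i == n))%:R).
  by apply: eq_bigr => m _; rewrite tail_descent // -ltnS.
rewrite sumrB sumrN -mulr_suml sum_wt -mulr_sumr.
rewrite [X in _ - _ * X]big_ord_recr /= eqxx /=.
have -> : \sum_(m < n) ((m == n :> nat) && (i == n))%:R = 0 :> R.
  by rewrite big1 // => m _; rewrite ltn_eqF.
rewrite !big_split /= -mulr_sumr sum_tail //.
have := abel (K^~ i) (fun _ => 1) n; rewrite tail_0 // tail_succ_len //.
rewrite [X in _ + X]big1 => [|m _]; last by rewrite subrr mulr0.
have := sum_wt_tail (fun _ => 1) le.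
have Sw : \sum_(m < n.+1) K m i + \sum_(m < n.+1) (w m - 1) * K m.+1 i =
  \sum_(m < n.+1) (K m i - K m.+1 i) * 1 + \sum_(m < n.+1) w m * K m.+1 i * 1.
  by rewrite -!big_split; apply: eq_bigr => m _ /=; ring.
rewrite Sw => -> ->.
have [lt|ge] := ltnP i n.
  rewrite sum_tail // (wt_lt lt) (ltn_eqF lt) /= => H; rewrite -[LHS]mulr1 mulr_suml; lra.
have -> : i = n by lia.
have -> : \sum_(m < n.+1) K n.+1 m = 0.
  by rewrite big1 // => m _; rewrite tail_succ_len // -ltnS.
rewrite wt_len eqxx /= => H; rewrite -[LHS]mulr1 mulr_suml; lra.
Qed.

(** By [tail_cvec] this is [tail_le_wt] in the last column. *)
Lemma cvec_ge_alpha j : (j < n)%N -> alpha j <= cv j.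
Proof.
move=> lt; have r0 := rhoX_gt0 k; have a0 := alpha_gt0 j.
have := tail_cvec k_gt0 lt; have := tail_le_wt (leqnn n) lt; rewrite wt_len => le eq.
rewrite -(ler_pM2l r0); nra.
Qed.

Lemma sum_cvec : \sum_(j < n) cv j = 2 * r - 2.
Proof.
have r0 := lt0r_neq0 (rhoX_gt0 k).
apply: (mulfI r0); apply: oppr_inj; rewrite mulr_sumr -sumrN.
have := sum_alpha_tail (leqnn n); rewrite ltnn => <-.
by apply: eq_bigr => j _; rewrite tail_cvec.
Qed.

(* [D_j(i)], with [j] shifted down by one. *)
Definition hcum j i : R := cv j + alpha j * K j.+1 i / w i.

Lemma hcum_len j : (j < n)%N -> hcum j n = 0.
Proof.
move=> lt; rewrite /hcum tail_cvec // wt_len; field.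
by rewrite gt_eqF ?rhoX_gt0.
Qed.

(** The extra unit for s_1 comes from the single nonzero K_j(0) with j > 0; it becomes the entry -1
    of S between x_0 - x_* and s_1. *)
Lemma hcum_0 j : (j < n)%N -> hcum j 0 = cv j + (j == 0%N)%:R.
Proof.
rewrite /hcum tail_col0 // eqSS (wt_lt len_gt0); case: eqP => [->|_] _.
  by rewrite mulr1 divff // gt_eqF ?alpha_gt0.
by rewrite mulr0 mul0r.
Qed.

Lemma hcum_alpha j i : (i < n)%N ->
  hcum j i * alpha i = cv j * alpha i + alpha j * K j.+1 i.
Proof. by move=> lt; rewrite /hcum wt_lt //; field; rewrite gt_eqF ?alpha_gt0. Qed.

Lemma sum_hcum i : (i < n)%N -> \sum_(j < n) hcum j i = 2 * r - 1.
Proof.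
move=> lt; rewrite /hcum big_split /= sum_cvec -mulr_suml sum_alpha_tail ?(ltnW lt) //.
by rewrite lt wt_lt // divff ?gt_eqF ?alpha_gt0 //; ring.
Qed.

Lemma hcum_mono j i : (i < n)%N -> i != j -> hcum j i <= hcum j i.+1.
Proof.
move=> lt ij; rewrite /hcum lerD2l -!mulrA ler_pM2l ?alpha_gt0 //.
by apply: ratio_mono.
Qed.

(** * Abel summation of the weighted inequalities *)

Lemma sum_lam j (phi : nat -> R) phis : (j <= n)%N ->
  w j * phis + \sum_(i < n.+1) (K i j - K i.+1 j) * phi i =
  w j * (phis - phi 0) + \sum_(i < n) K i.+1 j * (phi i.+1 - phi i).
Proof.
by move=> le; rewrite (abel (K^~ j)) tail_0 // tail_succ_len //; ring.
Qed.

(** The contribution of the parts phi_i - phi_j of the f-inequalities, phi being f or half a squared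
    gradient coordinate: by [sum_tail] the weights of the increments do not depend on i, so the sum
    telescopes. *)
Lemma sum_lam_sep (phi : nat -> R) phis :
  \sum_(j < n.+1) (w j * (phis - phi 0) + \sum_(i < n) K i.+1 j * (phi i.+1 - phi i))
  = (2 * r - 1) * (phis - phi n).
Proof.
rewrite big_split /= -mulr_suml sum_wt exchange_big /=.
under eq_bigr => i _ do rewrite -mulr_suml sum_tail //.
rewrite -mulr_sumr; have := abel (fun _ => 1) phi n.
rewrite big1 => [/esym|i _]; last by rewrite subrr mul0r.
under eq_bigr => i _ do rewrite mul1r.
move=> H; have -> : \sum_(i < n) (phi i.+1 - phi i) = phi n - phi 0 by lra.
ring.
Qed.

Lemma sum_mu j (phi : nat -> R) phis : (j < n)%N ->
  hcum j 0 * phis + \sum_(i < n) (hcum j i.+1 - hcum j i) * phi i.+1 =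
  hcum j 0 * (phis - phi 0) - \sum_(i < n) hcum j i * (phi i.+1 - phi i).
Proof.
move=> lt.
have H m : \sum_(i < m) (hcum j i.+1 - hcum j i) * phi i.+1 =
    hcum j m * phi m - hcum j 0 * phi 0 - \sum_(i < m) hcum j i * (phi i.+1 - phi i).
  elim: m => [|m IH]; first by rewrite !big_ord0; ring.
  by rewrite !big_ord_recr IH /=; ring.
by rewrite H hcum_len //; ring.
Qed.

Lemma sum_mu_sep (phi : nat -> R) phis :
  \sum_(j < n) (hcum j 0 * (phis - phi 0) - \sum_(i < n) hcum j i * (phi i.+1 - phi i))
  = (2 * r - 1) * (phis - phi n).
Proof.
rewrite sumrB -mulr_suml sum_hcum ?len_gt0 // exchange_big /=.
under eq_bigr => i _ do rewrite -mulr_suml sum_hcum //.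
rewrite -mulr_sumr; have := abel (fun _ => 1) phi n.
rewrite big1 => [/esym|i _]; last by rewrite subrr mul0r.
under eq_bigr => i _ do rewrite mul1r.
move=> H; have -> : \sum_(i < n) (phi i.+1 - phi i) = phi n - phi 0 by lra.
ring.
Qed.

(** The products g_i g_j, as in plain gradient descent. They form a bilinear sum -T with
    nonsymmetric coefficients; adding T to its transpose produces the left side of [tail_descent]
    entry by entry. *)
Lemma descent_form (g : nat -> R) :
  \sum_(j < n.+1) g j * (w j * g 0
     + \sum_(i < n) K i.+1 j * (- (alpha i * g i) - (g i.+1 - g i))) =
  2^-1 * ((\sum_(j < n.+1) w j * g j) ^+ 2 + (2 * r - 1) * g n ^+ 2).
Proof.
have -> : \sum_(j < n.+1) g j * (w j * g 0
     + \sum_(i < n) K i.+1 j * (- (alpha i * g i) - (g i.+1 - g i))) =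
  - \sum_(j < n.+1) \sum_(i < n.+1) g j * g i * (K i j + (w i - 1) * K i.+1 j).
  rewrite -sumrN; apply: eq_bigr => j _.
  have jn : (j <= n)%N by rewrite -ltnS.
  have := abel (K^~ j) g n; rewrite tail_0 // tail_succ_len // => A.
  have B := sum_wt_tail g jn.
  transitivity (- (g j * (\sum_(i < n.+1) (K i j - K i.+1 j) * g i
                          + \sum_(i < n.+1) w i * K i.+1 j * g i))).
    rewrite A B -mulrN; congr (_ * _).
    have -> : \sum_(i < n) K i.+1 j * (- (alpha i * g i) - (g i.+1 - g i)) =
        - (\sum_(i < n) K i.+1 j * (g i.+1 - g i) + \sum_(i < n) alpha i * K i.+1 j * g i).
      by rewrite -big_split -sumrN; apply: eq_bigr => i _ /=; ring.
    ring.
  by rewrite -big_split mulr_sumr; congr (- _); apply: eq_bigr => i _ /=; ring.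
set T := (X in - X = _).
have T2 : T + T = - ((\sum_(j < n.+1) w j * g j) ^+ 2 + (2 * r - 1) * g n ^+ 2).
  rewrite {2}/T exchange_big /= -big_split /=.
  transitivity (\sum_(j < n.+1) (- (w j * g j * \sum_(i < n.+1) w i * g i)
     - (2 * r - 1) * (g j * (j == n :> nat)%:R * \sum_(i < n.+1) g i * (i == n :> nat)%:R))).
    apply: eq_bigr => j _; rewrite -big_split /= !mulr_sumr -!sumrN -big_split /=.
    apply: eq_bigr => i _.
    have H := tail_descent (leq_ord i) (leq_ord j).
    transitivity (g j * g i * (K i j + (w i - 1) * K i.+1 j + (K j i + (w j - 1) * K j.+1 i))).
      ring.
    rewrite H -mulnb natrM; ring.
  have -> : \sum_(i < n.+1) g i * (i == n :> nat)%:R = g n.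
    rewrite big_ord_recr /= eqxx mulr1 big1 ?add0r // => i _.
    by rewrite ltn_eqF ?mulr0.
  rewrite sumrB sumrN -mulr_suml -mulr_sumr -mulr_suml.
  rewrite [X in _ - _ * (X * _)](_ : _ = g n); last first.
    rewrite big_ord_recr /= eqxx mulr1 big1 ?add0r // => i _.
    by rewrite ltn_eqF ?mulr0.
  ring.
lra.
Qed.

(* The block of [S] for [s_1, ..., s_n]; indices start at 0. *)
Definition core i j : R :=
  alpha j * cv i + alpha i * cv j + alpha i * K i.+1 j + alpha j * K j.+1 i
  - cv i * cv j.

(** * Positive semidefiniteness of S *)

Lemma coreC i j : core i j = core j i.
Proof. by rewrite /core; ring. Qed.

Lemma core_le0 i j : (i < n)%N -> (j < n)%N -> i != j -> core i j <= 0.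
Proof.
move=> li lj ij.
have ci := cvec_ge_alpha li; have cj := cvec_ge_alpha lj.
(* Exchanges the terms alpha K of [core] for the entries of [lam] and the product of the two
   steps. *)
have := tail_descent (ltnW li) (ltnW lj).
rewrite (ltn_eqF li) (wt_lt li) (wt_lt lj) /= mulr0 subr0 => D.
have := tail_anti (ltnW lj) ij; have := tail_anti (ltnW li) (_ : j != i).
rewrite eq_sym => /(_ ij) Kji Kij.
have : 0 <= (cv i - alpha i) * (cv j - alpha j) by rewrite mulr_ge0 ?subr_ge0.
by rewrite /core; lra.
Qed.

(** The entry between s_i and s_* being -c_i, this is the zero row sum of the Laplacian. *)
Lemma sum_core i : (i < n)%N -> \sum_(j < n) core i j = cv i.
Proof.
move=> li.
have -> : \sum_(j < n) core i j = cv i * \sum_(j < n) alpha j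
   + alpha i * \sum_(j < n) cv j + alpha i * \sum_(j < n) K i.+1 j
   + \sum_(j < n) alpha j * K j.+1 i - cv i * \sum_(j < n) cv j.
  rewrite !mulr_sumr -!big_split -sumrB.
  by apply: eq_bigr => j _; rewrite /core /=; ring.
have := sum_tail li; rewrite big_ord_recr /= => S1.
have := tail_cvec k_gt0 li; have := sum_alpha_tail (ltnW li); rewrite li => -> E.
rewrite sum_alpha sum_cvec (_ : \sum_(j < n) K i.+1 j = 1 - 2 * r - K i.+1 n); last by lra.
lra.
Qed.

(** The form as a sum over edges, with weight c_i to s_* (value t) and -[core i j] between two s;
    the factor 1/2 corrects for counting each pair twice. *)
Lemma core_form (v : nat -> R) (t : R) :
  \sum_(i < n) \sum_(j < n) core i j * v i * v j
  - 2 * t * \sum_(i < n) cv i * v i + (2 * r - 2) * t ^+ 2 =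
  \sum_(i < n) cv i * (v i - t) ^+ 2
  - 2^-1 * \sum_(i < n) \sum_(j < n) core i j * (v i - v j) ^+ 2.
Proof.
have row : \sum_(i < n) \sum_(j < n) core i j * v i ^+ 2 = \sum_(i < n) cv i * v i ^+ 2.
  by apply: eq_bigr => i _; rewrite -mulr_suml sum_core.
have col : \sum_(i < n) \sum_(j < n) core i j * v j ^+ 2 = \sum_(i < n) cv i * v i ^+ 2.
  rewrite exchange_big -row /=; apply: eq_bigr => i _; apply: eq_bigr => j _.
  by rewrite coreC.
have -> : \sum_(i < n) \sum_(j < n) core i j * (v i - v j) ^+ 2 =
   \sum_(i < n) \sum_(j < n) core i j * v i ^+ 2
   + \sum_(i < n) \sum_(j < n) core i j * v j ^+ 2
   - 2 * \sum_(i < n) \sum_(j < n) core i j * v i * v j.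
  rewrite mulr_sumr -big_split -sumrB; apply: eq_bigr => i _ /=.
  rewrite mulr_sumr -big_split -sumrB; apply: eq_bigr => j _ /=; ring.
rewrite row col.
have -> : \sum_(i < n) cv i * (v i - t) ^+ 2 =
  \sum_(i < n) cv i * v i ^+ 2 - 2 * t * \sum_(i < n) cv i * v i
  + t ^+ 2 * \sum_(i < n) cv i.
  rewrite !mulr_sumr -sumrB -big_split; apply: eq_bigr => i _ /=; ring.
rewrite sum_cvec; lra.
Qed.

Lemma sqrt2_le_cvec0 : Num.sqrt 2 <= cv 0.
Proof.
apply: le_trans (cvec_ge_alpha len_gt0).
rewrite -[alpha 0]/(alpha (len 0)) alpha_len expr0 div1r.
have : rho^-1 = Num.sqrt 2 - 1.
  have := rho_sq; have := lt0r_neq0 rho_gt0; rewrite /Defs.rho => rn rs.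
  by apply: (mulfI rn); rewrite mulfV //; lra.
lra.
Qed.

(** Index 0 is x_0 - x_*, then come s_1, ..., s_n, and n+1 is s_*. The corner 1/sqrt 2 equals
    rho/sqrt 2 - 1, what the coefficient of the squared initial distance leaves after u; the entry 2
    rho^k - 2 is the sum of c. *)
Definition Sfun (b c : nat) : R :=
  match b, c with
  | 0, 0 => (Num.sqrt 2)^-1
  | 0, j.+1 | j.+1, 0 => if j == n then 1 else - (j == 0%N)%:R
  | i.+1, j.+1 =>
    if i == n then (if j == n then 2 * r - 2 else - cv j)
    else if j == n then - cv i else core i j
  end.

Lemma SfunC b c : Sfun b c = Sfun c b.
Proof. by case: b c => [|i] [|j] //=; case: eqP; case: eqP => // _ _; apply: coreC. Qed.

Lemma sum_ends (F : nat -> R) m :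
  \sum_(b < m.+2) F b = F 0 + (\sum_(i < m) F i.+1 + F m.+1).
Proof. by rewrite big_ord_recl big_ord_recr. Qed.

Lemma Sfun_form (v : nat -> R) :
  \sum_(b < n.+2) \sum_(c < n.+2) v b * Sfun b c * v c =
  (Num.sqrt 2)^-1 * v 0 ^+ 2 - 2 * v 0 * (v 1%N - v n.+1)
  + (\sum_(i < n) \sum_(j < n) core i j * v i.+1 * v j.+1
     - 2 * v n.+1 * \sum_(i < n) cv i * v i.+1 + (2 * r - 2) * v n.+1 ^+ 2).
Proof.
have first : \sum_(j < n) v j.+1 * (j == 0 :> nat)%:R = v 1%N.
  have := len_gt0; case: n => // m _.
  by rewrite big_ord_recl /= mulr1 big1 ?addr0 // => i _; rewrite mulr0.
rewrite (sum_ends (fun b => \sum_(c < n.+2) v b * Sfun b c * v c)).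
rewrite (sum_ends (fun c => v 0 * Sfun 0 c * v c)).
rewrite (sum_ends (fun c => v n.+1 * Sfun n.+1 c * v c)) /= eqxx.
have -> : \sum_(i < n) v 0 * (if i == n :> nat then 1 else - (i == 0 :> nat)%:R) * v i.+1
    = - (v 0 * v 1%N).
  rewrite -first mulr_sumr -sumrN; apply: eq_bigr => i _; rewrite ltn_eqF //; ring.
have -> : \sum_(i < n) v n.+1 * (if i == n :> nat then 2 * r - 2 else - cv i) * v i.+1
    = - (v n.+1 * \sum_(i < n) cv i * v i.+1).
  rewrite mulr_sumr -sumrN; apply: eq_bigr => i _; rewrite ltn_eqF //; ring.
under eq_bigr => i _ do rewrite (sum_ends (fun c => v i.+1 * Sfun i.+1 c * v c)) /= ltn_eqF // eqxx.
rewrite !big_split /=.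
have -> : \sum_(i < n) v i.+1 * - (i == 0 :> nat)%:R * v 0 = - (v 0 * v 1%N).
  rewrite -first mulr_sumr -sumrN; apply: eq_bigr => i _; ring.
have -> : \sum_(i < n) v i.+1 * - cv i * v n.+1 = - (v n.+1 * \sum_(i < n) cv i * v i.+1).
  rewrite mulr_sumr -sumrN; apply: eq_bigr => i _; ring.
have -> : \sum_(i < n) \sum_(j < n) v i.+1 * (if j == n :> nat then - cv i else core i j) * v j.+1
  = \sum_(i < n) \sum_(j < n) core i j * v i.+1 * v j.+1.
  apply: eq_bigr => i _; apply: eq_bigr => j _; rewrite ltn_eqF //; ring.
ring.
Qed.

Lemma Sfun_psd (v : nat -> R) :
  0 <= \sum_(b < n.+2) \sum_(c < n.+2) v b * Sfun b c * v c.
Proof.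
rewrite Sfun_form (core_form (fun i => v i.+1)).
have off : \sum_(i < n) \sum_(j < n) core i j * (v i.+1 - v j.+1) ^+ 2 <= 0.
  apply: sumr_le0 => i _; apply: sumr_le0 => j _.
  have [->|ij] := eqVneq (i : nat) j; first by rewrite subrr expr0n mulr0.
  by rewrite mulr_le0_ge0 ?sqr_ge0 ?core_le0.
have s0 : 0 < Num.sqrt 2 :> R by rewrite sqrtr_gt0; lra.
have star : Num.sqrt 2 * (v 1%N - v n.+1) ^+ 2 <= \sum_(i < n) cv i * (v i.+1 - v n.+1) ^+ 2.
  rewrite (bigD1 (Ordinal len_gt0)) //= -[leLHS]addr0 lerD //.
    by rewrite ler_wpM2r ?sqr_ge0 ?sqrt2_le_cvec0.
  apply: sumr_ge0 => i _; rewrite mulr_ge0 ?sqr_ge0 //.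
  by apply: le_trans (cvec_ge_alpha (ltn_ord i)); rewrite ltW ?alpha_gt0.
(* Completing the square in [v 0] costs sqrt 2 times the squared difference of s_1 and s_*, which
   [star] supplies. *)
have : 0 <= (Num.sqrt 2)^-1 * (v 0 - Num.sqrt 2 * (v 1%N - v n.+1)) ^+ 2.
  by rewrite mulr_ge0 ?sqr_ge0 // invr_ge0 ltW.
have -> : (Num.sqrt 2)^-1 * (v 0 - Num.sqrt 2 * (v 1%N - v n.+1)) ^+ 2 =
  (Num.sqrt 2)^-1 * v 0 ^+ 2 - 2 * v 0 * (v 1%N - v n.+1)
  + Num.sqrt 2 * (v 1%N - v n.+1) ^+ 2.
  by field; rewrite gt_eqF.
lra.
Qed.

(** * The identity in one coordinate *)

Lemma scalar_identity (x g v : nat -> R) (xs : R) :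
  v 0 = x 0 - xs ->
  (forall i, (i < n)%N -> x i.+1 = x i - alpha i * (g i + v i.+1)) ->
  \sum_(j < n.+1) (w j * (g j * (xs - x j) + 2^-1 * (- v n.+1 - g j) ^+ 2)
     + \sum_(i < n.+1) (K i j - K i.+1 j) * (g j * (x i - x j) + 2^-1 * (g i - g j) ^+ 2))
  + \sum_(j < n) (hcum j 0 * (v j.+1 * (xs - x j.+1))
     + \sum_(i < n) (hcum j i.+1 - hcum j i) * (v j.+1 * (x i.+1 - x j.+1)))
  = 2^-1 * ((x 0 - xs - \sum_(i < n) alpha i * g i - r * g n
              - \sum_(j < n) cv j * v j.+1 - v n.+1) ^+ 2
            + \sum_(b < n.+2) \sum_(c < n.+2) v b * Sfun b c * v c)
    - rho / (2 * Num.sqrt 2) * (x 0 - xs) ^+ 2.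
Proof.
move=> v0 xS.
set z := x 0 - xs in v0 *; set t := v n.+1.
set G := \sum_(j < n.+1) w j * g j.
set C := \sum_(j < n) cv j * v j.+1.
set A := \sum_(i < n) alpha i * g i.
(* [X] gathers mixed products of s and g, which enter [F] and [H] with opposite signs; [Y] gathers
   the products of two s. *)
set X := \sum_(j < n) \sum_(i < n) alpha i * v i.+1 * (K i.+1 j * g j).
set Y := \sum_(j < n) \sum_(i < n) v j.+1 * v i.+1 * (alpha i * cv j + alpha j * K j.+1 i).
have GA : G = A + r * g n.
  rewrite /G big_ord_recr /= wt_len; congr (_ + _).
  by apply: eq_bigr => i _; rewrite wt_lt.
have F : \sum_(j < n.+1) (w j * (g j * (xs - x j) + 2^-1 * (- t - g j) ^+ 2)
     + \sum_(i < n.+1) (K i j - K i.+1 j) * (g j * (x i - x j) + 2^-1 * (g i - g j) ^+ 2))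
   = - (z - t) * G + 2^-1 * G ^+ 2 + 2^-1 * (2 * r - 1) * t ^+ 2 - X + r * g n * C.
  transitivity (\sum_(j < n.+1) (- (z - t) * (w j * g j)
      + g j * (w j * g 0 + \sum_(i < n) K i.+1 j * (- (alpha i * g i) - (g i.+1 - g i)))
      - \sum_(i < n) alpha i * v i.+1 * (K i.+1 j * g j)
      + (w j * (2^-1 * t ^+ 2 - 2^-1 * g 0 ^+ 2)
         + \sum_(i < n) K i.+1 j * (2^-1 * g i.+1 ^+ 2 - 2^-1 * g i ^+ 2)))).
    apply: eq_bigr => j _.
    rewrite (sum_lam (fun i => g j * (x i - x j) + 2^-1 * (g i - g j) ^+ 2)) ?leq_ord //.
    have -> : \sum_(i < n) K i.+1 j * (g j * (x i.+1 - x j) + 2^-1 * (g i.+1 - g j) ^+ 2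
         - (g j * (x i - x j) + 2^-1 * (g i - g j) ^+ 2)) =
      g j * \sum_(i < n) K i.+1 j * (- (alpha i * g i) - (g i.+1 - g i))
      - \sum_(i < n) alpha i * v i.+1 * (K i.+1 j * g j)
      + \sum_(i < n) K i.+1 j * (2^-1 * g i.+1 ^+ 2 - 2^-1 * g i ^+ 2).
      rewrite mulr_sumr -sumrB -big_split; apply: eq_bigr => i _ /=.
      by rewrite xS //; field.
    by rewrite /z; field.
  rewrite !big_split /= sumrN -mulr_sumr descent_form -/G.
  rewrite -big_split /= (sum_lam_sep (fun i => 2^-1 * g i ^+ 2)).
  rewrite big_ord_recr /= -/X.
  (* The column of x_n lies outside [X]; [tail_cvec] turns it into the g_n share of the product of
     [G] and [C]. *)
  have -> : \sum_(i < n) alpha i * v i.+1 * (K i.+1 n * g n) = - (r * g n * C).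
    rewrite mulr_sumr -sumrN; apply: eq_bigr => i _.
    rewrite [LHS](_ : _ = alpha i * K i.+1 n * (v i.+1 * g n)); last by ring.
    by rewrite tail_cvec //; ring.
  by field.
have H : \sum_(j < n) (hcum j 0 * (v j.+1 * (xs - x j.+1))
     + \sum_(i < n) (hcum j i.+1 - hcum j i) * (v j.+1 * (x i.+1 - x j.+1)))
   = - z * (C + v 1%N) + A * C + X + Y.
  transitivity (\sum_(j < n) (- z * (cv j * v j.+1) - z * (v j.+1 * (j == 0 :> nat)%:R)
    + A * (cv j * v j.+1)
    + \sum_(i < n) alpha j * v j.+1 * (K j.+1 i * g i)
    + \sum_(i < n) v j.+1 * v i.+1 * (alpha i * cv j + alpha j * K j.+1 i))).
    apply: eq_bigr => j _.
    rewrite (sum_mu (fun i => v j.+1 * (x i - x j.+1))) // hcum_0 //.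
    have -> : \sum_(i < n) hcum j i * (v j.+1 * (x i.+1 - x j.+1) - v j.+1 * (x i - x j.+1))
      = - (A * (cv j * v j.+1) + \sum_(i < n) alpha j * v j.+1 * (K j.+1 i * g i)
      + \sum_(i < n) v j.+1 * v i.+1 * (alpha i * cv j + alpha j * K j.+1 i)).
      rewrite /A mulr_suml -!big_split -sumrN; apply: eq_bigr => i _ /=.
      transitivity (- (hcum j i * alpha i) * (v j.+1 * (g i + v i.+1))).
        by rewrite xS //; ring.
      by rewrite hcum_alpha //; ring.
    by rewrite /z; ring.
  rewrite !big_split /= sumrN -!mulr_sumr.
  have -> : \sum_(j < n) v j.+1 * (j == 0 :> nat)%:R = v 1%N.
    have := len_gt0; case: n => // m _.
    by rewrite big_ord_recl /= mulr1 big1 ?addr0 // => i _; rewrite mulr0.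
  by rewrite -/C -/Y [X in _ + X + Y]exchange_big /= -/X; ring.
(* The coefficients of [Y] are not symmetric; symmetrized, they are [core] plus the rank-one term
   from the square of u. *)
have Y2 : Y + Y = \sum_(i < n) \sum_(j < n) core i j * v i.+1 * v j.+1 + C ^+ 2.
  rewrite {2}/Y exchange_big /= -big_split expr2 {1}/C mulr_suml -big_split.
  apply: eq_bigr => j _ /=; rewrite -big_split mulr_sumr -big_split.
  by apply: eq_bigr => i _; rewrite /core /=; ring.
rewrite F H Sfun_form -/t v0 -/C.
have s2 : Num.sqrt (2 : R) != 0 by rewrite gt_eqF // sqrtr_gt0; lra.
have -> : rho / (2 * Num.sqrt 2) = 2^-1 + 2^-1 * (Num.sqrt 2)^-1.
  by rewrite /Defs.rho; field.
have -> : z - A - r * g n - C - t = z - G - C - t by rewrite GA; ring.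
have -> : A = G - r * g n by rewrite GA; ring.
lra.
Qed.

(** * The certificate in the indexing of the theorem *)

Definition lamc (i : option 'I_n.+1) (j : 'I_n.+1) : R :=
  if i is Some i then K i j - K i.+1 j else w j.

(** The shift [j.-1] appears because [hcum] counts s_1, ..., s_n from 0. *)
Definition muc (i : option 'I_n.+1) (j : 'I_n.+1) : R :=
  if i is Some i then hcum j.-1 i - hcum j.-1 i.-1 else hcum j.-1 0.

Definition Sc : 'M[R]_(n.+2) := \matrix_(b, c) Sfun b c.

Lemma lamc_ge0 i (j : 'I_n.+1) : i != Some j -> 0 <= lamc i j.
Proof.
case: i => [i|] /= ij; last by rewrite ltW ?wt_gt0.
by rewrite subr_ge0 tail_anti ?leq_ord.
Qed.

Lemma muc_ge0 i (j : 'I_n.+1) :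
  i != Some ord0 -> j != ord0 -> i != Some j -> 0 <= muc i j.
Proof.
case: j => -[|j] //= lj; case: i => [[[|i] li]|] //= _ _ ij.
  by rewrite subr_ge0 hcum_mono.
by rewrite hcum_0 // addr_ge0 // (le_trans _ (cvec_ge_alpha _)) // ltW ?alpha_gt0.
Qed.

Lemma trmx_Sc : Sc^T = Sc.
Proof. by apply/matrixP => b c; rewrite !mxE SfunC. Qed.

Lemma Sc_form m (V : 'M[R]_(m, n.+2)) a :
  (V *m Sc *m V^T) a a = \sum_(b < n.+2) \sum_(c < n.+2) V a b * Sfun b c * V a c.
Proof.
rewrite mxE exchange_big; apply: eq_bigr => c _.
by rewrite !mxE mulr_suml; apply: eq_bigr => b _; rewrite !mxE.
Qed.

Lemma Sc_psd (v : 'rV[R]_(n.+2)) : 0 <= (v *m Sc *m v^T) 0 0.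
Proof.
rewrite Sc_form; have := Sfun_psd (fun b => v 0 (inord b)).
by under eq_bigr => b _ do under eq_bigr => c _ do rewrite !inord_val.
Qed.

Lemma sum_option (T : nmodType) m (F : option 'I_m -> T) :
  \sum_i F i = F None + \sum_(i < m) F (Some i).
Proof.
rewrite (bigD1 None) //=; congr (_ + _).
rewrite (reindex_omap Some id) /=; last by case.
by apply: eq_bigl => i; rewrite eqxx.
Qed.

Lemma sum_neq0 (T : nmodType) m (F : 'I_m.+1 -> T) :
  \sum_(i < m.+1 | i != ord0) F i = \sum_(i < m) F (lift ord0 i).
Proof.
by rewrite big_mkcond big_ord_recl eqxx /= add0r.
Qed.

Lemma sum_option_neq0 (T : nmodType) m (F : option 'I_m.+1 -> T) :
  \sum_(i | i != Some ord0) F i = F None + \sum_(i < m) F (Some (lift ord0 i)).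
Proof.
by rewrite big_mkcond sum_option big_ord_recl eqxx /= add0r.
Qed.

(** Separates function values from inner products and norms, which are then treated coordinate by
    coordinate. *)
Lemma weighted_split d m p (ws : 'I_p -> R) (L : 'I_m -> 'I_p -> R)
    (As : 'I_p -> R) (A : 'I_m -> 'I_p -> R)
    (Bs : 'I_p -> 'I_d -> R) (B : 'I_m -> 'I_p -> 'I_d -> R) :
  \sum_(j < p) (ws j * (As j - \sum_(a < d) Bs j a)
    + \sum_(i < m) L i j * (A i j - \sum_(a < d) B i j a)) =
  \sum_(j < p) (ws j * As j + \sum_(i < m) L i j * A i j)
  - \sum_(a < d) \sum_(j < p) (ws j * Bs j a + \sum_(i < m) L i j * B i j a).
Proof.
rewrite [X in _ - X]exchange_big -sumrB; apply: eq_bigr => j _ /=.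
rewrite big_split /= -mulr_sumr [X in _ - (_ + X)]exchange_big /=.
have -> : \sum_(i < m) L i j * (A i j - \sum_(a < d) B i j a) =
  \sum_(i < m) L i j * A i j - \sum_(i < m) \sum_(a < d) L i j * B i j a.
  by rewrite -sumrB; apply: eq_bigr => i _; rewrite -mulr_sumr; ring.
ring.
Qed.

Lemma enorm_sq d (u : 'rV[R]_d) : enorm u ^+ 2 = \sum_(a < d) u 0 a ^+ 2.
Proof.
rewrite /enorm sqr_sqrtr /dotv; last by apply: sumr_ge0 => a _; rewrite -expr2 sqr_ge0.
by apply: eq_bigr => a _; rewrite expr2.
Qed.

(** * From one coordinate to vectors *)

Section Identity.
Variables (d : nat) (f h : 'rV[R]_d -> R) (gf : 'rV[R]_d -> 'rV[R]_d).
Variables (x : nat -> 'rV[R]_d) (xs : 'rV[R]_d).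

Let sig i := (alpha i)^-1 *: (x i - alpha i *: gf (x i) - x i.+1).
Let vc (a : 'I_d) (b : nat) : R :=
  if b is i.+1 then (if i == n then - gf xs 0 a else sig i 0 a) else x 0%N 0 a - xs 0 a.

Lemma Vmx_coord (a : 'I_d) (b : 'I_n.+2) : Vmx n gf x xs a b = vc a b.
Proof.
rewrite mxE /Vcol /vc; case: b => -[|b] lb /=; first by rewrite !mxE.
have [ltb|geb] := ltnP b n; first by rewrite ltn_eqF //= inordK.
by rewrite (_ : b == n) ?mxE //; lia.
Qed.

Lemma sum_lamc_Qf :
  \sum_(i : option 'I_n.+1) \sum_(j : 'I_n.+1) lamc i j * Qf f gf x xs i (Some j) =
  (2 * r - 1) * (f xs - f (x n))
  - \sum_(a < d) \sum_(j < n.+1)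
      (w j * (gf (x j) 0 a * (xs 0 a - x j 0 a) + 2^-1 * (- vc a n.+1 - gf (x j) 0 a) ^+ 2)
       + \sum_(i < n.+1) (K i j - K i.+1 j)
          * (gf (x j) 0 a * (x i 0 a - x j 0 a) + 2^-1 * (gf (x i) 0 a - gf (x j) 0 a) ^+ 2)).
Proof.
have QfE i (j : 'I_n.+1) : Qf f gf x xs i (Some j) = f (pt x xs i) - f (x j)
    - \sum_(a < d) (gf (x j) 0 a * (pt x xs i 0 a - x j 0 a)
        + 2^-1 * (gr gf x xs i 0 a - gf (x j) 0 a) ^+ 2).
  rewrite /Qf enorm_sq big_split /= -mulr_sumr /dotv /gr /=.
  under eq_bigr => a _ do rewrite !mxE.
  under [X in _ - _ * X]eq_bigr => a _ do rewrite !mxE.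
  ring.
transitivity (\sum_(j < n.+1) (w j * (f xs - f (x j)
      - \sum_(a < d) (gf (x j) 0 a * (xs 0 a - x j 0 a)
          + 2^-1 * (gf xs 0 a - gf (x j) 0 a) ^+ 2))
    + \sum_(i < n.+1) (K i j - K i.+1 j) * (f (x i) - f (x j)
      - \sum_(a < d) (gf (x j) 0 a * (x i 0 a - x j 0 a)
          + 2^-1 * (gf (x i) 0 a - gf (x j) 0 a) ^+ 2)))).
  rewrite exchange_big; apply: eq_bigr => j _ /=.
  by rewrite sum_option QfE; congr (_ + _); apply: eq_bigr => i _; rewrite QfE.
rewrite weighted_split /=; congr (_ - _).
  rewrite -(sum_lam_sep (f \o x)); apply: eq_bigr => j _.
  rewrite (sum_lam (fun i => f (x i) - f (x j))) ?leq_ord //.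
  congr (_ * _ + _); first by rewrite /=; ring.
  by apply: eq_bigr => i _ /=; ring.
apply: eq_bigr => a _; apply: eq_bigr => j _.
by rewrite /vc eqxx opprK.
Qed.

Lemma sum_muc_Qh :
  \sum_(i : option 'I_n.+1 | i != Some ord0) \sum_(j : 'I_n.+1 | j != ord0)
    muc i j * Qh h gf x xs i (Some j) =
  (2 * r - 1) * (h xs - h (x n))
  - \sum_(a < d) \sum_(j < n) (hcum j 0 * (vc a j.+1 * (xs 0 a - x j.+1 0 a))
     + \sum_(i < n) (hcum j i.+1 - hcum j i) * (vc a j.+1 * (x i.+1 0 a - x j.+1 0 a))).
Proof.
have QhE i (j : 'I_n) : Qh h gf x xs i (Some (lift ord0 j)) = h (pt x xs i) - h (x j.+1)
    - \sum_(a < d) vc a j.+1 * (pt x xs i 0 a - x j.+1 0 a).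
  rewrite /Qh; congr (_ - _); apply: eq_bigr => a _.
  by rewrite /vc ltn_eqF // !mxE.
under eq_bigr => i _ do rewrite sum_neq0.
rewrite sum_option_neq0.
transitivity (\sum_(j < n) (hcum j 0 * (h xs - h (x j.+1)
      - \sum_(a < d) vc a j.+1 * (xs 0 a - x j.+1 0 a))
    + \sum_(i < n) (hcum j i.+1 - hcum j i) * (h (x i.+1) - h (x j.+1)
      - \sum_(a < d) vc a j.+1 * (x i.+1 0 a - x j.+1 0 a)))).
  rewrite exchange_big -big_split; apply: eq_bigr => j _ /=.
  rewrite QhE; congr (_ + _); apply: eq_bigr => i _.
  by rewrite QhE.
rewrite weighted_split; congr (_ - _).
rewrite -(sum_mu_sep (h \o x)); apply: eq_bigr => j _.
rewrite (sum_mu (fun i => h (x i) - h (x j.+1))) //.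
congr (_ * _ - _); first by rewrite /=; ring.
by apply: eq_bigr => i _ /=; ring.
Qed.

Lemma certificate_identity :
  let u := x 0%N - xs
           - \sum_(i < n) alpha i *: gf (x i)
           - r *: gf (x n)
           - \sum_(j < n) cv j *: sv gf x xs (Some (lift ord0 j))
           - sv gf x xs (None : option 'I_n.+1) in
  \sum_(i : option 'I_n.+1) \sum_(j : 'I_n.+1) lamc i j * Qf f gf x xs i (Some j)
  + \sum_(i : option 'I_n.+1 | i != Some ord0) \sum_(j : 'I_n.+1 | j != ord0)
      muc i j * Qh h gf x xs i (Some j)
  = (2 * r - 1) * ((f xs + h xs) - (f (x n) + h (x n)))
    + rho / (2 * Num.sqrt 2) * enorm (x 0%N - xs) ^+ 2
    - 2^-1 * (enorm u ^+ 2 + \tr (Vmx n gf x xs *m Sc *m (Vmx n gf x xs)^T)).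
Proof.
move=> u; rewrite sum_lamc_Qf sum_muc_Qh /mxtrace !enorm_sq.
under [X in _ - _ * (_ + X)]eq_bigr => a _.
  rewrite Sc_form; under eq_bigr => b _ do under eq_bigr => c _ do rewrite !Vmx_coord.
  over.
have key : \sum_(a < d) \sum_(j < n.+1)
      (w j * (gf (x j) 0 a * (xs 0 a - x j 0 a) + 2^-1 * (- vc a n.+1 - gf (x j) 0 a) ^+ 2)
       + \sum_(i < n.+1) (K i j - K i.+1 j)
          * (gf (x j) 0 a * (x i 0 a - x j 0 a) + 2^-1 * (gf (x i) 0 a - gf (x j) 0 a) ^+ 2))
  + \sum_(a < d) \sum_(j < n) (hcum j 0 * (vc a j.+1 * (xs 0 a - x j.+1 0 a))
     + \sum_(i < n) (hcum j i.+1 - hcum j i) * (vc a j.+1 * (x i.+1 0 a - x j.+1 0 a)))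
  = 2^-1 * (\sum_(a < d) u 0 a ^+ 2 + \sum_(a < d)
        \sum_(b < n.+2) \sum_(c < n.+2) vc a b * Sfun b c * vc a c)
    - rho / (2 * Num.sqrt 2) * \sum_(a < d) (x 0%N - xs) 0 a ^+ 2.
  rewrite -!big_split !mulr_sumr -sumrB; apply: eq_bigr => a _ /=.
  rewrite [LHS](scalar_identity (x := fun i => x i 0 a) (g := fun i => gf (x i) 0 a)
    (v := vc a) (xs := xs 0 a)) //; last first.
    (* The recursion is the definition of s_(i+1) solved for x_(i+1). *)
    move=> i lt; rewrite /= ltn_eqF // !mxE.
    by field; rewrite gt_eqF ?alpha_gt0.
  congr (_ * (_ ^+ 2 + _) - _ * _ ^+ 2); last by rewrite !mxE.
  have -> : vc a n.+1 = - gf xs 0 a by rewrite /vc eqxx.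
  rewrite /u !mxE !summxE; congr (_ - _ - _ - _ - _).
  - by apply: eq_bigr => i _; rewrite mxE.
  - by apply: eq_bigr => i _; rewrite mxE /= ltn_eqF.
have -> : forall p q s t : R, p - q + (s - t) = p + s - (q + t) by move=> *; ring.
rewrite key; ring.
Qed.

End Identity.

End Certificate.
End Silver.

Theorem theorem9 (R : realType) (k : nat) (hk : (0 < k)%N) :
  let n := (2 ^ k - 1)%N in
  exists (lam : option 'I_n.+1 -> 'I_n.+1 -> R)
         (mu : option 'I_n.+1 -> 'I_n.+1 -> R)
         (S : 'M[R]_(n.+2)),
    (forall (i : option 'I_n.+1) (j : 'I_n.+1), i != Some j -> 0 <= lam i j) /\
    (forall (i : option 'I_n.+1) (j : 'I_n.+1),
        i != Some ord0 -> j != ord0 -> i != Some j -> 0 <= mu i j) /\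
    S^T = S /\
    (forall v : 'rV[R]_(n.+2), 0 <= (v *m S *m v^T) 0 0) /\
    (forall (d : nat) (f h : 'rV[R]_d -> R) (gf : 'rV[R]_d -> 'rV[R]_d)
            (x : nat -> 'rV[R]_d) (xs : 'rV[R]_d),
       convex_fun f ->
       (forall y, is_gradient f y (gf y)) ->
       (forall y z, enorm (gf y - gf z) <= enorm (y - z)) ->
       convex_fun h ->
       (forall z, f xs + h xs <= f z + h z) ->
       (forall t, (t < n)%N ->
          is_prox (alpha R t) h (x t - alpha R t *: gf (x t)) (x t.+1)) ->
       let u := x 0%N - xs
                - \sum_(i < n) alpha R i *: gf (x i)
                - (rho R) ^+ k *: gf (x n)
                - \sum_(j < n) nth 0 (cvec R k) j *: sv gf x xs (Some (lift ord0 j))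
                - sv gf x xs (None : option 'I_n.+1) in
       \sum_(i : option 'I_n.+1) \sum_(j : 'I_n.+1)
           lam i j * Qf f gf x xs i (Some j)
       + \sum_(i : option 'I_n.+1 | i != Some ord0) \sum_(j : 'I_n.+1 | j != ord0)
           mu i j * Qh h gf x xs i (Some j)
       = (2 * (rho R) ^+ k - 1) * ((f xs + h xs) - (f (x n) + h (x n)))
         + rho R / (2 * Num.sqrt 2) * enorm (x 0%N - xs) ^+ 2
         - 2^-1 * (enorm u ^+ 2 + \tr (Vmx n gf x xs *m S *m (Vmx n gf x xs)^T))).
Proof.
exists (@lamc R k), (@muc R k), (@Sc R k); split; first exact: lamc_ge0.
split; first exact: muc_ge0.
split; first exact: trmx_Sc.
split; first exact: Sc_psd.
by move=> d f h gf x xs _ _ _ _ _ _; exact: certificate_identity.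
Qed.
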